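(* Let $d,n$ be positive integers and $\alpha,\delta\in[0,1]$ with $\alpha>0$. If there exists a $2$-query $(\alpha,\delta)$-approximate LDC of size $n$ and dimension $d$, then for every integer $k>1/\alpha^2$ there exists a simple $2$-query $(\alpha',\delta')$-approximate LDC of size $n'$ and dimension $d$ with $\alpha'\ge\sqrt{\alpha^2-1/k}$, $\delta'\ge\delta-k/d$ and $n'\le 2n$.
   Context: For $\vec u\in\mathbb R^d$ nonzero, $\mathsf{weight}_i(\vec u)=|\langle \vec u,\vec e_i\rangle|/\|\vec u\|_2$, where $\vec e_i$ is the $i$-th standard basis vector. A $2$-matching in $[n]$ is a set of pairwise disjoint $2$-element subsets of $[n]$. A $2$-query $(\alpha,\delta)$-approximate LDC of size $n$ and dimension $d$ is a pair $(V,M)$ where $V=\{\vec v_1,\dots,\vec v_n\}$ is a multiset of vectors in $\mathbb R^d$ and $M=(M_1,\dots,M_d)$, each $M_i$ a $2$-matching in $[n]$, such that for every $i$ and $\{j_1,j_2\}\in M_i$ there is $\vec u\in\mathrm{span}\{\vec v_{j_1},\vec v_{j_2}\}$ with $\mathsf{weight}_i(\vec u)\ge\alpha$, and $|M_1|+\cdots+|M_d|\ge\delta dn$. Such a code is simple if for every $i\in[d]$ and $\{j_1,j_2\}\in M_i$, $\mathsf{weight}_i(\vec v_{j_2}-\vec v_{j_1})\ge\alpha$. *)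

(* Defs.v *)
From HB Require Import structures.
From mathcomp Require Import all_boot all_order all_algebra.
From mathcomp Require Import reals.

Set Implicit Arguments.
Unset Strict Implicit.
Unset Printing Implicit Defensive.

Import Order.TTheory GRing.Theory Num.Theory.
Local Open Scope ring_scope.

Definition dotp (R : realType) (d : nat) (u v : 'rV[R]_d) : R :=
  \sum_(i < d) u 0 i * v 0 i.

Definition norm2 (R : realType) (d : nat) (u : 'rV[R]_d) : R :=
  Num.sqrt (dotp u u).

(* [delta_mx 0 i] is the [i]-th standard basis vector. The weight is meant for
   [u != 0] only (it is the junk value 0 at [u = 0]); every use below carries
   the nonvanishing condition explicitly. *)
Definition weight (R : realType) (d : nat) (i : 'I_d) (u : 'rV[R]_d) : R :=
  `|dotp u (delta_mx 0 i)| / norm2 u.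

Definition matching2 (n : nat) (E : {set {set 'I_n}}) : Prop :=
  (forall e : {set 'I_n}, e \in E -> #|e| = 2%N) /\
  (forall e f : {set 'I_n}, e \in E -> f \in E -> e <> f -> [disjoint e & f]).

(* The multiset of code vectors is the indexed family [v], so repetitions are
   allowed. *)
Definition approx_LDC2 (R : realType) (alpha delta : R) (n d : nat)
    (v : 'I_n -> 'rV[R]_d) (M : 'I_d -> {set {set 'I_n}}) : Prop :=
  [/\ forall i : 'I_d, matching2 (M i),
      forall (i : 'I_d) (j1 j2 : 'I_n), [set j1; j2] \in M i ->
        exists u : 'rV[R]_d,
          [/\ u \in <<[:: v j1; v j2]>>%VS, u != 0 & alpha <= weight i u]
    & delta * d%:R * n%:R <= (\sum_(i < d) #|M i|)%N%:R].

Definition simple_approx_LDC2 (R : realType) (alpha delta : R) (n d : nat)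
    (v : 'I_n -> 'rV[R]_d) (M : 'I_d -> {set {set 'I_n}}) : Prop :=
  approx_LDC2 alpha delta v M /\
  forall (i : 'I_d) (j1 j2 : 'I_n), [set j1; j2] \in M i ->
    v j2 - v j1 != 0 /\ alpha <= weight i (v j2 - v j1).

(* Main.v *)
Require Import Defs.
From HB Require Import structures.
From mathcomp Require Import all_boot all_order all_algebra.
From mathcomp Require Import reals.
From mathcomp Require Import ring lra.

Set Implicit Arguments.
Unset Strict Implicit.
Unset Printing Implicit Defensive.

Import Order.TTheory GRing.Theory Num.Theory.
Local Open Scope ring_scope.

(** Normalise the code vectors to unit length and drop from each [M i] the edges
    meeting a vector [w] with [w_i ^ 2 > 1/k]: a unit vector has at most [k] such
    coordinates, so at most [k n] edges are lost. For a surviving edge with unit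
    vectors [x], [y], the sum [x + y] and the difference [x - y] are orthogonal
    and span the same plane as [x], [y], so the squares of their [i]-th weights
    add up to at least [alpha ^ 2]. On the other hand, since
    [(x_i + y_i)^2 + (x_i - y_i)^2 <= 4/k = (|x + y|^2 + |x - y|^2) / k], one of
    the two squares is at most [1/k], hence the other one is at least
    [alpha ^ 2 - 1/k]. Taking both [w] and [-w] as code vectors makes sums
    into differences, and each surviving edge lifts to two edges of this double
    cover. *)

(** * Dot products, norms and normalisation *)

Section DotProduct.
Variables (R : realType) (d : nat).
Implicit Types (u v w : 'rV[R]_d) (i : 'I_d).

Lemma dotpC u v : dotp u v = dotp v u.
Proof. by apply: eq_bigr => i _; rewrite mulrC. Qed.

Lemma dotpDl u v w : dotp (u + v) w = dotp u w + dotp v w.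
Proof. by rewrite /dotp -big_split; apply: eq_bigr => i _; rewrite mxE mulrDl. Qed.

Lemma dotpZl a u v : dotp (a *: u) v = a * dotp u v.
Proof. by rewrite /dotp mulr_sumr; apply: eq_bigr => i _; rewrite mxE mulrA. Qed.

Lemma dotpDr u v w : dotp u (v + w) = dotp u v + dotp u w.
Proof. by rewrite !(dotpC u) dotpDl. Qed.

Lemma dotpZr a u v : dotp u (a *: v) = a * dotp u v.
Proof. by rewrite !(dotpC u) dotpZl. Qed.

Lemma dotp_delta u i : dotp u (delta_mx 0 i) = u 0 i.
Proof.
rewrite /dotp (bigD1 i) //= big1 => [|j /negPf ji]; last by rewrite mxE ji mulr0.
by rewrite mxE !eqxx mulr1 addr0.
Qed.

Lemma dotp_ge0 u : 0 <= dotp u u.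
Proof. by apply: sumr_ge0 => i _; rewrite -expr2 sqr_ge0. Qed.

Lemma sqr_coord_le_dotp u i : u 0 i ^+ 2 <= dotp u u.
Proof.
rewrite /dotp (bigD1 i) //= -expr2 lerDl.
by apply: sumr_ge0 => j _; rewrite -expr2 sqr_ge0.
Qed.

Lemma dotp_eq0 u : (dotp u u == 0) = (u == 0).
Proof.
apply/eqP/eqP => [u0|->]; last by apply: big1 => i _; rewrite mxE mul0r.
apply/rowP => i; rewrite mxE; apply/eqP; rewrite -sqrf_eq0 eq_le sqr_ge0 andbT.
by rewrite -u0 sqr_coord_le_dotp.
Qed.

Lemma dotp_gt0 u : (0 < dotp u u) = (u != 0).
Proof. by rewrite lt_def dotp_ge0 andbT dotp_eq0. Qed.

Lemma sqr_norm2 u : norm2 u ^+ 2 = dotp u u.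
Proof. by rewrite sqr_sqrtr ?dotp_ge0. Qed.

Lemma norm2_gt0 u : (0 < norm2 u) = (u != 0).
Proof. by rewrite sqrtr_gt0 dotp_gt0. Qed.

Lemma weightN i u : weight i (- u) = weight i u.
Proof.
rewrite /weight /norm2 !dotp_delta mxE normrN.
by rewrite -scaleN1r dotpZl dotpZr !mulN1r opprK.
Qed.

Lemma le_weight (a : R) i u : 0 <= a -> u != 0 ->
  (a <= weight i u) = (a ^+ 2 * dotp u u <= u 0 i ^+ 2).
Proof.
move=> a0 u0; rewrite /weight dotp_delta ler_pdivlMr ?norm2_gt0 //.
rewrite -(@ler_pXn2r _ 2) ?nnegrE ?normr_ge0 //; last first.
  by rewrite mulr_ge0 // sqrtr_ge0.
by rewrite exprMn sqr_norm2 real_normK // num_real.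
Qed.

(** The zero vector is sent to itself, so zero code vectors can be kept in the family. *)
Definition normalize u := (norm2 u)^-1 *: u.

Lemma normalizeK u : norm2 u *: normalize u = u.
Proof.
have [->|u0] := eqVneq u 0; first by rewrite /normalize !scaler0.
by rewrite scalerA mulfV ?scale1r // gt_eqF // norm2_gt0.
Qed.

Lemma dotp_normalize u : dotp (normalize u) (normalize u) = (u != 0)%:R.
Proof.
rewrite dotpZl dotpZr -sqr_norm2; have [->|u0] := eqVneq u 0.
  by rewrite sqr_norm2 (eqP (_ : dotp 0 0 == 0)) ?dotp_eq0 // !mulr0.
by rewrite /= mulr1n; field; rewrite gt_eqF // norm2_gt0.
Qed.

Lemma mem_span2P (x y u : 'rV[R]_d) :
  u \in <<[:: x; y]>>%VS -> exists a b, u = a *: x + b *: y.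
Proof.
rewrite span_cons span_seq1 => /memv_addP[_ /vlineP[a ->]].
by move=> [_ /vlineP[b ->] ->]; exists a, b.
Qed.

End DotProduct.

(* [x], [y] are the [i]-th coordinates of two orthogonal vectors of squared norms
   [A], [B], and [p], [q] the coefficients of a vector of squared weight at least
   [a]. *)
Lemma orthogonal_weight (R : realType) (A B x y p q a c : R) :
  x ^+ 2 <= A -> y ^+ 2 <= B -> x ^+ 2 <= c * A -> 0 <= c < a ->
  0 < p ^+ 2 * A + q ^+ 2 * B ->
  a * (p ^+ 2 * A + q ^+ 2 * B) <= (p * x + q * y) ^+ 2 ->
  0 < B /\ (a - c) * B <= y ^+ 2.
Proof.
move=> xA yB xc /andP[c0 ca] N0 aN.
have A0 : 0 <= A by apply: le_trans xA; rewrite sqr_ge0.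
have B0 : 0 <= B by apply: le_trans yB; rewrite sqr_ge0.
(* If [B = 0], the combination lies along the first vector, whose squared weight is at most
   [c < a]. *)
have B1 : 0 < B.
  rewrite lt_def B0 andbT; apply/eqP => BE; move: yB N0 aN; rewrite {}BE => yB.
  have -> : y = 0 by apply/eqP; rewrite -sqrf_eq0 eq_le yB sqr_ge0.
  rewrite !mulr0 !addr0 exprMn => N0 aN.
  have := ler_wpM2l (sqr_ge0 p) xc; have := ltr_pM2r N0 c a; rewrite ca; lra.
split=> //; rewrite leNgt; apply/negP => yl.
have [A1|A1] := eqVneq A 0.
  have x0 : x = 0 by apply/eqP; rewrite -sqrf_eq0 eq_le sqr_ge0 andbT -A1.
  move: N0 aN; rewrite A1 x0 !mulr0 !add0r exprMn => N0 aN.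
  have q0 : 0 < q ^+ 2 by rewrite -(pmulr_lgt0 _ B1).
  have := mulr_ge0 c0 (ltW N0).
  have : q ^+ 2 * y ^+ 2 < q ^+ 2 * ((a - c) * B) by rewrite ltr_pM2l.
  lra.
have {A1} A1 : 0 < A by rewrite lt_def A1.
set N := p ^+ 2 * A + q ^+ 2 * B in N0 aN.
(* Cauchy-Schwarz with denominators cleared: a squared weight in the plane is at most
   [x ^+ 2 / A + y ^+ 2 / B]. *)
have CS : A * B * (p * x + q * y) ^+ 2 <= (x ^+ 2 * B + y ^+ 2 * A) * N.
  rewrite -subr_ge0 [X in 0 <= X](_ : _ = (p * y * A - q * x * B) ^+ 2).
    exact: sqr_ge0.
  by rewrite /N; ring.
have lt : x ^+ 2 * B + y ^+ 2 * A < a * A * B.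
  have := ler_wpM2r B0 xc; have : y ^+ 2 * A < (a - c) * B * A by rewrite ltr_pM2r.
  lra.
have := ler_wpM2l (mulr_ge0 A0 B0) aN.
have : (x ^+ 2 * B + y ^+ 2 * A) * N < a * A * B * N by rewrite ltr_pM2r.
lra.
Qed.

(** * Weights of sums and differences of normalised vectors *)

Section Weights.
Variables (R : realType) (d : nat) (i : 'I_d).
Implicit Types (u x y z : 'rV[R]_d).

Definition heavier (a : R) z := (z != 0) && (a <= weight i z).

Lemma heavierN a z : heavier a (- z) = heavier a z.
Proof. by rewrite /heavier oppr_eq0 weightN. Qed.

Lemma heavier_unit_sum_or_diff (a c : R) x y u p q :
  dotp x x = 1 -> dotp y y = 1 -> x 0 i ^+ 2 <= c -> y 0 i ^+ 2 <= c ->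
  0 <= c < a -> u != 0 -> u = p *: x + q *: y ->
  a * dotp u u <= u 0 i ^+ 2 ->
  heavier (Num.sqrt (a - c)) (x + y) || heavier (Num.sqrt (a - c)) (x - y).
Proof.
move=> x1 y1 xc yc /[dup] ca /andP[c0 ca'] u0 uE au.
have DS : dotp (x + y) (x + y) = 2 + 2 * dotp x y.
  by rewrite !(dotpDl, dotpDr) x1 y1 (dotpC y x); ring.
have DD : dotp (x - y) (x - y) = 2 - 2 * dotp x y.
  by rewrite -scaleN1r !(dotpDl, dotpDr, dotpZl, dotpZr) x1 y1 (dotpC y x); ring.
(* The coefficients of [u] on the orthogonal pair [x + y], [x - y] are [(p + q) / 2] and
   [(p - q) / 2]. *)
have DU : dotp u u = ((p + q) / 2) ^+ 2 * dotp (x + y) (x + y)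
                   + ((p - q) / 2) ^+ 2 * dotp (x - y) (x - y).
  by rewrite DS DD uE !(dotpDl, dotpDr, dotpZl, dotpZr) x1 y1 (dotpC y x); field.
have DI : u 0 i = (p + q) / 2 * (x + y) 0 i + (p - q) / 2 * (x - y) 0 i.
  by rewrite uE !mxE; field.
have u1 : 0 < dotp u u by rewrite dotp_gt0.
have hv z : 0 < dotp z z /\ (a - c) * dotp z z <= z 0 i ^+ 2 ->
    heavier (Num.sqrt (a - c)) z.
  move=> [z0 az]; rewrite /heavier -dotp_gt0 z0 le_weight ?sqrtr_ge0 -?dotp_gt0 //.
  by rewrite sqr_sqrtr // subr_ge0 ltW.
have sS := sqr_coord_le_dotp (x + y) i; have sD := sqr_coord_le_dotp (x - y) i.
have [le|lt] := leP ((x + y) 0 i ^+ 2) (c * dotp (x + y) (x + y)).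
  apply/orP; right; apply: hv; apply: (@orthogonal_weight _ _ _ _ _ ((p + q) / 2) ((p - q) / 2) _ _ sS sD le ca).
    by rewrite -DU.
  by rewrite -DU -DI.
apply/orP; left; apply: hv; apply: (@orthogonal_weight _ _ _ _ _ ((p - q) / 2) ((p + q) / 2) _ _ sD sS _ ca).
(* The squared coordinates of [x + y] and [x - y] add up to at most [4 * c], and the squared norms
   to [4]; an excess for the sum forces a deficit for the difference. *)
- move: lt; rewrite DS DD !mxE; have := sqr_ge0 (x 0 i - y 0 i); nra.
- by rewrite addrC -DU.
- by rewrite addrC -DU [X in _ <= X ^+ 2]addrC -DI.
Qed.

Lemma heavier_sum_or_diff (a c : R) x y u :
  0 < a -> 0 <= c < a ^+ 2 ->
  normalize x 0 i ^+ 2 <= c -> normalize y 0 i ^+ 2 <= c ->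
  u \in <<[:: x; y]>>%VS -> u != 0 -> a <= weight i u ->
  heavier (Num.sqrt (a ^+ 2 - c)) (normalize x + normalize y) ||
  heavier (Num.sqrt (a ^+ 2 - c)) (normalize x - normalize y).
Proof.
move=> a0 ca xc yc /mem_span2P[p [q uE]] u0.
rewrite le_weight ?(ltW a0) // => au.
(* Were [x] or [y] zero, [u] would be a multiple of the other one, whose squared weight is at most
   [c < a ^+ 2]. *)
have no_line z r : normalize z 0 i ^+ 2 <= c -> u <> r *: z.
  move=> zc uz; move: u0 au; rewrite {}uz -(normalizeK z) scalerA -dotp_gt0.
  set s := r * _; rewrite dotpZl dotpZr dotp_normalize mxE exprMn.
  case: (z != 0); last by rewrite mulr0n !mulr0 ltxx.
  have := ler_wpM2l (sqr_ge0 s) zc; case/andP: ca => c0 ca.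
  rewrite mulr1n; nra.
have x0 : x != 0 by apply/eqP => x0; apply: (no_line y q yc); rewrite uE x0 scaler0 add0r.
have y0 : y != 0 by apply/eqP => y0; apply: (no_line x p xc); rewrite uE y0 scaler0 addr0.
apply: (@heavier_unit_sum_or_diff (a ^+ 2) c _ _ u (p * norm2 x) (q * norm2 y)) => //.
- by rewrite dotp_normalize x0.
- by rewrite dotp_normalize y0.
- by rewrite -!scalerA !normalizeK.
Qed.

End Weights.

(** The squared coordinates sum to at most 1, and each one counted exceeds [1/k]. *)
Lemma card_heavy_coord (R : realType) (d k : nat) (u : 'rV[R]_d) :
  (0 < k)%N -> (#|[set i | (k%:R^-1 < normalize u 0 i ^+ 2)%R]| <= k)%N.
Proof.
move=> k0; rewrite -(ler_nat R); set H := [set i | _].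
have kR : 0 < k%:R :> R by rewrite ltr0n.
rewrite -[leRHS]mulr1 -ler_pdivrMl // mulrC.
apply: (@le_trans _ _ (dotp (normalize u) (normalize u))); last first.
  by rewrite dotp_normalize; case: (u != 0); rewrite ?ler01.
rewrite mulr_natl -sumr_const /dotp [leRHS](bigID (mem H)) /= -[leLHS]addr0.
apply: lerD.
  by apply: ler_sum => i; rewrite inE -expr2 => /ltW.
by apply: sumr_ge0 => i _; rewrite -expr2 sqr_ge0.
Qed.

(** * Matchings and their lifts to a double cover *)

Section Matchings.
Variable n : nat.
Implicit Types (E S : {set {set 'I_n}}) (H : {set 'I_n}).

Lemma matching2_sub E S : S \subset E -> matching2 E -> matching2 S.
Proof.
move=> /subsetP sub [E2 Ed]; split=> [e /sub /E2 //|e f /sub eE /sub fE].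
exact: Ed.
Qed.

Lemma matching2_eq E e f j :
  matching2 E -> e \in E -> f \in E -> j \in e -> j \in f -> e = f.
Proof.
move=> [_ Ed] eE fE je jf; apply/eqP/negPn/negP => /eqP ef.
by have /disjointFr/(_ je) := Ed _ _ eE fE ef; rewrite jf.
Qed.

(** Picking a vertex of [H] on each such edge is injective, as the edges are disjoint. *)
Lemma card_matching2_meet E H :
  matching2 E -> (#|[set e in E | ~~ [disjoint e & H]]| <= #|H|)%N.
Proof.
move=> mE; set D := [set e in E | _].
pose f (e : {set 'I_n}) := [pick j in e :&: H].
have fP e : e \in D -> exists j, [/\ f e = Some j, j \in e & j \in H].
  rewrite inE -setI_eq0 => /andP[_ /set0Pn[j jI]].
  rewrite /f; case: pickP => [j'|/(_ j)]; last by rewrite jI.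
  by rewrite inE => /andP[? ?]; exists j'.
have f_inj : {in D &, injective f}.
  move=> e e' eD e'D; have [j [-> je _]] := fP _ eD; have [j' [-> je' _]] := fP _ e'D.
  move=> [jj']; rewrite -jj' in je'.
  by move: eD e'D; rewrite !inE => /andP[eE _] /andP[e'E _]; apply: (matching2_eq mE eE e'E je je').
rewrite -(card_in_imset f_inj) -(card_imset (mem H) Some_inj).
apply/subset_leq_card/subsetP => _ /imsetP[e /fP[j [-> _ jH]] ->].
exact: imset_f.
Qed.

(* ['I_(n + n)] as two copies of ['I_n]; the vector indexed by the copy [true]
   will be the opposite of the one indexed by the copy [false]. *)
Definition copy (b : bool) (j : 'I_n) : 'I_(n + n) :=
  if b then rshift n j else lshift n j.

Lemma copy_inj b b' j j' : copy b j = copy b' j' -> b = b' /\ j = j'.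
Proof.
case: b; case: b' => /=.
- by move/rshift_inj.
- by move/eqP; rewrite eq_rlshift.
- by move/eqP; rewrite eq_lrshift.
- by move/lshift_inj.
Qed.

(* [t] marks the smaller endpoint of each edge on which [P] holds; a marked vertex
   is lifted to the opposite copy. *)
Lemma double_cover_matching2 E (P : rel 'I_n) :
  matching2 E -> symmetric P ->
  exists E' : {set {set 'I_(n + n)}},
    [/\ matching2 E', #|E'| = (2 * #|E|)%N &
      forall x1 x2, [set x1; x2] \in E' -> exists b1 b2 j1 j2,
        [/\ x1 = copy b1 j1, x2 = copy b2 j2, [set j1; j2] \in E
          & b1 (+) b2 = P j1 j2]].
Proof.
move=> mE Psym; have [E2 _] := mE.
pose t j := [exists j', [&& [set j; j'] \in E, (j < j')%N & P j j']].
have tP j1 j2 : [set j1; j2] \in E -> t j1 (+) t j2 = P j1 j2.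
  wlog le12 : j1 j2 / (j1 <= j2)%N => [hw|eE].
    have [/hw//|/ltnW le21 eE] := leqP j1 j2.
    by rewrite addbC Psym; apply: hw; rewrite 1?setUC.
  have lt12 : (j1 < j2)%N.
    rewrite ltn_neqAle le12 andbT; apply/eqP => /val_inj eq12.
    by have := E2 _ eE; rewrite eq12 setUid cards1.
  have other j j' : [set j; j'] \in E -> j = j1 /\ j' = j2 \/ j = j2 /\ j' = j1 \/
      j != j1 /\ j != j2.
    move=> fE; have [jj1|jn1] := eqVneq j j1.
      left; split=> //; have := matching2_eq mE eE fE (set21 _ _).
      rewrite jj1 set21 => /(_ isT)/setP/(_ j2); rewrite !inE eqxx orbT.
      by rewrite eq_sym => /esym/orP[/eqP h|/eqP->//]; rewrite -h ltnn in lt12.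
    have [jj2|jn2] := eqVneq j j2; last by right; right.
    right; left; split=> //; have := matching2_eq mE eE fE (set22 _ _).
    rewrite jj2 set21 => /(_ isT)/setP/(_ j1); rewrite !inE eqxx /=.
    by move=> /esym/orP[/eqP h|/eqP->//]; rewrite -h ltnn in lt12.
  (* Only the smaller endpoint [j1] can be marked, so the mark of [j1] alone records [P]. *)
  have -> : t j2 = false.
    apply/existsP => -[j /and3P[/other + lt _]].
    case=> [[h _]|[[_ h]|[_]]]; last by rewrite eqxx.
      by rewrite h ltnn in lt12.
    by rewrite h ltnNge ltnW in lt.
  rewrite addbF; apply/existsP/idP => [[j /and3P[/other + lt p]]|p]; last first.
    by exists j2; rewrite eE lt12.
  case=> [[_ <-]//|[[h _]|[]]]; last by rewrite eqxx.
  by rewrite h ltnn in lt12.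
(* The bit [c] selects one of the two lifts of an edge; it cancels in [b1 (+) b2], leaving
   [t j1 (+) t j2]. *)
pose phi c j := copy (c (+) t j) j.
have phi_inj c : injective (phi c) by move=> j j' /copy_inj[].
have phi_eq c c' j j' : phi c j = phi c' j' -> c = c' /\ j = j'.
  by move=> /copy_inj[+ jj']; rewrite jj' => /addIb.
pose lft (p : bool * {set 'I_n}) := phi p.1 @: p.2.
pose D := setX [set: bool] E.
(* Lifts sharing a vertex come from the same pair; this yields both the disjointness of the lifted
   edges and their number. *)
have meet p q x : p \in D -> q \in D -> x \in lft p -> x \in lft q -> p = q.
  case: p q => [c e] [c' e']; rewrite !inE /= => eE e'E /imsetP[j je ->] /imsetP[j' je'].
  by move=> /= /phi_eq[/= -> jj']; rewrite -jj' in je'; rewrite (matching2_eq mE eE e'E je je').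
exists (lft @: D); split.
- split=> [_ /imsetP[[c e] + ->]|_ _ /imsetP[p pD ->] /imsetP[q qD ->] npq].
    by rewrite !inE /= => /E2 e2; rewrite /lft card_imset.
  rewrite -setI_eq0; apply/eqP/setP => x; rewrite !inE; apply/negP => /andP[xp xq].
  by apply: npq; rewrite (meet p q x).
- rewrite card_in_imset ?cardsX ?cardsT ?card_bool // => p q pD qD pq.
  have /set0Pn[x xp] : lft p != set0.
    by case: p pD {pq} => c e; rewrite !inE /= => /E2 e2; rewrite -card_gt0 card_imset ?e2.
  by apply: (meet p q x) => //; rewrite -pq.
- move=> x1 x2 /imsetP[[c e]]; rewrite !inE /= => eE xE.
  have : x1 \in lft (c, e) by rewrite -xE set21.
  have : x2 \in lft (c, e) by rewrite -xE set22.
  move=> /imsetP[j2 /= j2e x2E] /imsetP[j1 /= j1e x1E].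
  exists (c (+) t j1), (c (+) t j2), j1, j2.
  have je : [set j1; j2] = e.
    apply/eqP; rewrite eqEcard; apply/andP; split.
      by apply/subsetP => j; rewrite !inE => /orP[]/eqP->.
    rewrite (E2 _ eE) cards2; case: eqVneq => // jj.
    have : #|[set x1; x2]| = 2 by rewrite xE card_imset //= E2.
    by rewrite x1E x2E jj setUid cards1.
  split=> //; first by rewrite je.
  rewrite -tP ?je //; by case: (c); case: (t j1); case: (t j2).
Qed.

End Matchings.

(** * The code made of the normalised vectors and their opposites *)

Definition signed_family (R : realType) (d n : nat) (w : 'I_n -> 'rV[R]_d)
    (x : 'I_(n + n)) : 'rV[R]_d :=
  match fintype.split x with inl j => w j | inr j => - w j end.

Lemma signed_family_copy (R : realType) (d n : nat) (w : 'I_n -> 'rV[R]_d) b j :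
  signed_family w (copy b j) = (-1) ^+ b *: w j.
Proof.
case: b; rewrite /signed_family /copy.
  by rewrite (unsplitK (inr j)) scaleN1r.
by rewrite (unsplitK (inl j)) scale1r.
Qed.

Lemma simple_approx_LDC2_heavier (R : realType) (alpha delta : R) (n d : nat)
    (v : 'I_n -> 'rV[R]_d) (M : 'I_d -> {set {set 'I_n}}) :
  (forall i, matching2 (M i)) ->
  (forall i j1 j2, [set j1; j2] \in M i -> heavier i alpha (v j2 - v j1)) ->
  delta * d%:R * n%:R <= (\sum_(i < d) #|M i|)%N%:R ->
  simple_approx_LDC2 alpha delta v M.
Proof.
move=> mM hM cM; split; last by move=> i j1 j2 /hM/andP[].
split=> // i j1 j2 /hM/andP[nz hw]; exists (v j2 - v j1); split=> //.
by apply: rpredB; apply: memv_span; rewrite !inE eqxx ?orbT.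
Qed.

Theorem theorem5 (R : realType) (d n : nat) (alpha delta : R)
  (hd : (0 < d)%N) (hn : (0 < n)%N)
  (halpha : 0 < alpha <= 1) (hdelta : 0 <= delta <= 1)
  (hLDC : exists (v : 'I_n -> 'rV[R]_d) (M : 'I_d -> {set {set 'I_n}}),
     approx_LDC2 alpha delta v M)
  (k : nat) (hk : 1 / alpha ^+ 2 < k%:R) :
  exists (n' : nat) (alpha' delta' : R)
         (v' : 'I_n' -> 'rV[R]_d) (M' : 'I_d -> {set {set 'I_n'}}),
    [/\ simple_approx_LDC2 alpha' delta' v' M',
        Num.sqrt (alpha ^+ 2 - 1 / k%:R) <= alpha',
        delta - k%:R / d%:R <= delta'
      & (0 < n' <= 2 * n)%N].
Proof.
have [v [M [mM spanM cardM]]] := hLDC; case/andP: halpha => a0 _.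
have kR : 0 < k%:R :> R.
  by apply: lt_trans hk; rewrite divr_gt0 // exprn_gt0.
have k0 : (0 < k)%N by rewrite ltr0n in kR.
have ka : 0 <= (k%:R^-1 : R) < alpha ^+ 2.
  apply/andP; split; first by rewrite invr_ge0 ltW.
  rewrite -[ltLHS]mul1r ltr_pdivrMr // mulrC -ltr_pdivrMr //.
  by rewrite exprn_gt0.
pose w j := normalize (v j).
pose H i := [set j | k%:R^-1 < w j 0 i ^+ 2].
pose S i := [set e in M i | [disjoint e & H i]].
pose a' := Num.sqrt (alpha ^+ 2 - k%:R^-1).
(* When the difference is too light, the sum must be heavy, so the edge has to join opposite
   signs. *)
pose P i : rel 'I_n := fun j1 j2 => ~~ heavier i a' (w j1 - w j2).
have mS i : matching2 (S i).
  by apply: matching2_sub (mM i); apply/subsetP => e; rewrite inE => /andP[].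
have Psym i : symmetric (P i).
  by move=> j1 j2; rewrite /P -heavierN opprB.
have [M' M'P] := fin_all_exists (fun i => double_cover_matching2 (mS i) (Psym i)).
have lostM : (\sum_(i < d) #|M i| <= \sum_(i < d) #|S i| + k * n)%N.
  apply: (@leq_trans (\sum_(i < d) (#|S i| + #|H i|))).
    apply: leq_sum => i _; rewrite -(cardsID [set e : {set 'I_n} | [disjoint e & H i]] (M i)).
    apply: leq_add.
      by apply: subset_leq_card; apply/subsetP => e; rewrite !inE.
    apply: leq_trans (card_matching2_meet (H i) (mM i)).
    by apply: subset_leq_card; apply/subsetP => e; rewrite !inE andbC.
  rewrite big_split leq_add2l.
  rewrite (eq_bigr (fun i => \sum_(j < n) (j \in H i)))%N; last first.
    by move=> i _; rewrite -sum1_card big_mkcond; apply: eq_bigr => j _; case: (_ \in _).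
  (* Double counting: each of the [n] vectors is heavy in at most [k] coordinates. *)
  rewrite exchange_big /= mulnC -[n in (n * k)%N]card_ord -sum_nat_const.
  apply: leq_sum => j _; apply: leq_trans (card_heavy_coord (v j) k0).
  rewrite -sum1_card [leqRHS]big_mkcond; apply: leq_sum => i _.
  by rewrite !inE; case: ifP.
exists (n + n)%N, a', (delta - k%:R / d%:R), (signed_family w), M'; split.
- apply: simple_approx_LDC2_heavier => [i|i x1 x2|]; first by have [] := M'P i.
    have [_ _ /[apply]] := M'P i; move=> [b1 [b2 [j1 [j2 [-> -> + bE]]]]].
    rewrite inE => /andP[jM djH].
    have light j : j \in [set j1; j2] -> w j 0 i ^+ 2 <= k%:R^-1.
      by move=> /(disjointFr djH); rewrite inE leNgt => ->.
    have [u [uS u0 uw]] := spanM i j1 j2 jM.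
    have := heavier_sum_or_diff a0 ka (light _ (set21 _ _)) (light _ (set22 _ _)) uS u0 uw.
    rewrite -/(w j1) -/(w j2) -/a'; move: bE; rewrite /P !signed_family_copy.
    (* Equal signs give the difference up to sign, opposite signs the sum up to sign. *)
    case: b1; case: b2 => /= /esym bE; rewrite ?scaleN1r ?scale1r.
    + by move: bE => /negbFE; rewrite opprK addrC.
    + by rewrite (negbTE bE) orbF opprK addrC.
    + by rewrite (negbTE bE) orbF -opprD heavierN addrC.
    + by move: bE => /negbFE; rewrite -heavierN opprB.
  have -> : (\sum_(i < d) #|M' i| = 2 * \sum_(i < d) #|S i|)%N.
    by rewrite big_distrr; apply: eq_bigr => i _; have [] := M'P i.
  have dR : d%:R != 0 :> R by rewrite pnatr_eq0 -lt0n.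
  move: lostM; rewrite -(ler_nat R) natrD !natrM natrD => lostM.
  (* Doubling both the vertices and the surviving edges keeps the density, so losing [k * n] edges
     costs exactly [k / d]. *)
  have -> : (delta - k%:R / d%:R) * d%:R * (n%:R + n%:R)
      = 2 * (delta * d%:R * n%:R - k%:R * n%:R) by field.
  lra.
- by rewrite div1r.
- by [].
- by rewrite addnn mul2n leqnn double_gt0 hn.
Qed.
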